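(* Let $\Gamma_P$ be a finite index set, and for each $k\in\Gamma_P$ let $a_k,b_k,\lambda_k,c_k>0$ be real numbers. Let $P_c>0$ and $E_c>0$. Consider the total received power maximization problem (TRPM) $$\max_{(p_k)_{k\in\Gamma_P}}\ \sum_{k\in\Gamma_P}a_k\log(1+b_k\lambda_kp_k)$$ subject to $$0\le p_k\le\min\left(\frac{c_k}{\lambda_k},P_c\right)\quad\text{for all }k\in\Gamma_P,\qquad \sum_{k\in\Gamma_P}p_k\le E_c .$$ Then the optimal value $p_k^{*}$ of $p_k$ in this problem is $$p_k^{*}=\begin{cases} h a_k-\dfrac{1}{b_k\lambda_k}, & \text{if } 0< h a_k-\dfrac{1}{b_k\lambda_k}<\min\left(P_c,\dfrac{c_k}{\lambda_k}\right),\\[2mm] \min\left(P_c,\dfrac{c_k}{\lambda_k}\right), & \text{if } h a_k-\dfrac{1}{b_k\lambda_k}\ge \min\left(P_c,\dfrac{c_k}{\lambda_k}\right),\\[2mm] 0, & \text{otherwise,}\end{cases}\qquad k\in\Gamma_P,$$ where $h$ is the Lagrange multiplier (more precisely, the reciprocal $h=1/\nu$ of the multiplier $\nu$ of the total power constraint) satisfying $\sum_{k\in\Gamma_P}p_k^{*}=E_c$.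
   Context: Interpretation: $\Gamma_P$ indexes the selected sensors; $p_k$ is the power transmitted to sensor $k$; $\lambda_k$ is the eigenvalue of its (rank-one) channel gain matrix, so that the received RF power is $\lambda_kp_k$; $a_k,b_k$ are the parameters of the logarithmic energy harvesting model $r(x)=a_k\log(1+b_kx)$, $0\le x\le c_k$, with $c_k$ the operation limit of the rectifier; $P_c$ is the transmission power limit on each orthogonal frequency band; $E_c$ is the total transmission power budget.
   Formalization: An h with total power equal to E_c is asserted only when E_c ≤ sum of min(P_c, c_k/λ_k); if E_c is larger no feasible point spends the budget (ν = 0), and the formula is shown to hold for some h > 0 without that equation. *)

(* Defs.v *)
From HB Require Import structures.
From mathcomp Require Import all_boot all_order all_algebra.
From mathcomp Require Import all_classical all_reals all_analysis.
Set Implicit Arguments.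
Unset Strict Implicit.
Unset Printing Implicit Defensive.
Import Order.TTheory GRing.Theory Num.Theory.
Import numFieldNormedType.Exports.
Local Open Scope ring_scope.

Definition power_cap (R : realType) (I : finType) (lam c : I -> R) (Pc : R)
    (k : I) : R :=
  Num.min (c k / lam k) Pc.

Definition total_received_power (R : realType) (I : finType)
    (a b lam p : I -> R) : R :=
  \sum_k a k * ln (1 + b k * lam k * p k).

Definition trpm_feasible (R : realType) (I : finType) (lam c : I -> R)
    (Pc Ec : R) (p : I -> R) : Prop :=
  (forall k, 0 <= p k <= power_cap lam c Pc k) /\ \sum_k p k <= Ec.

Definition trpm_optimal (R : realType) (I : finType) (a b lam c : I -> R)
    (Pc Ec : R) (p : I -> R) : Prop :=
  trpm_feasible lam c Pc Ec p /\
  forall q, trpm_feasible lam c Pc Ec q ->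
    total_received_power a b lam q <= total_received_power a b lam p.

Definition water_filling (R : realType) (I : finType) (a b lam c : I -> R)
    (Pc h : R) (k : I) : R :=
  let w := h * a k - 1 / (b k * lam k) in
  let m := power_cap lam c Pc k in
  if 0 < w < m then w else if m <= w then m else 0.

(* [nu], [mu k] and [omega k] are the multipliers of the constraints
   [\sum_k p k <= Ec], [0 <= p k] and [p k <= power_cap lam c Pc k]. *)
Definition trpm_lagrangian (R : realType) (I : finType) (a b lam c : I -> R)
    (Pc Ec nu : R) (mu omega p : I -> R) : R :=
  total_received_power a b lam p - nu * (\sum_k p k - Ec)
  + \sum_k mu k * p k - \sum_k omega k * (p k - power_cap lam c Pc k).

(* The Karush-Kuhn-Tucker conditions at [p], with the multipliers of the
   individual bounds quantified existentially; stationarity is the vanishing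
   of every partial derivative of the Lagrangian in the powers. *)
Definition budget_multiplier (R : realType) (I : finType)
    (a b lam c : I -> R) (Pc Ec : R) (p : I -> R) (nu : R) : Prop :=
  exists mu omega : I -> R,
    [/\ trpm_feasible lam c Pc Ec p,
        0 <= nu /\ (forall k, 0 <= mu k /\ 0 <= omega k),
        nu * (\sum_k p k - Ec) = 0,
        (forall k, mu k * p k = 0 /\
                   omega k * (p k - power_cap lam c Pc k) = 0)
      & forall k, is_derive (p k) (1 : R)
          (fun x : R => trpm_lagrangian a b lam c Pc Ec nu mu omega
                          [eta p with k |-> x]) 0].

(* Main.v *)
Require Import Defs.
From HB Require Import structures.
From mathcomp Require Import all_boot all_order all_algebra.
From mathcomp Require Import all_classical all_reals all_analysis.
From mathcomp Require Import ring lra.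
Set Implicit Arguments.
Unset Strict Implicit.
Unset Printing Implicit Defensive.
Import Order.TTheory GRing.Theory Num.Theory.
Import numFieldNormedType.Exports.
Local Open Scope ring_scope.

(* The water-filling value [W = clamp (w, 0, m)] is characterised by
   [W < m -> w <= W] and [0 < W -> W <= w], which says that the marginal gain
   [a beta / (1 + beta W)], with [beta = b lam], is at most, resp. at least,
   [1 / h]: these are the KKT conditions.  Strict concavity of [ln] then makes
   [W] the unique maximiser of [a ln (1 + beta x) - x / h] over [0, m]; since
   no feasible point has a larger total power, summing over the sensors gives
   unique optimality.  A suitable [h] is found by the intermediate value theorem
   when the budget can be spent, and by saturating all caps otherwise. *)

(** This is [1 + t < expR t] at [t = x / y - 1], nonzero because [x != y]. Its strictness is the
    source of uniqueness of the optimum. *)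
Lemma ln_sub_lt (R : realType) (x y : R) : 0 < x -> 0 < y -> x != y ->
  ln x - ln y < (x - y) / y.
Proof.
move=> x0 y0 xy.
have t0 : x / y - 1 != 0.
  apply: contra_neq xy => /eqP; rewrite subr_eq0 => /eqP e.
  by rewrite -[x](mulfVK (lt0r_neq0 y0)) e mul1r.
have := expR_gt1Dx t0; rewrite subrKC -[X in X < _]lnK ?posrE ?divr_gt0 //.
by rewrite ltr_expR ln_div ?posrE // mulrBl divff ?gt_eqF.
Qed.

(** * The water-filling value as a clamp *)

Lemma power_cap_gt0 (R : realType) (I : finType) (lam c : I -> R) (Pc : R)
    (k : I) :
  0 < lam k -> 0 < c k -> 0 < Pc -> 0 < power_cap lam c Pc k.
Proof. by move=> l0 c0 P0; rewrite /power_cap lt_min divr_gt0. Qed.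

(** Lattice operations replace the nested tests, which makes continuity in [h] visible. A positive
    cap makes the outer maximum harmless once the cap is reached. *)
Lemma water_fillingE (R : realType) (I : finType) (a b lam c : I -> R)
    (Pc h : R) (k : I) :
  0 < power_cap lam c Pc k ->
  water_filling a b lam c Pc h k =
  Num.max 0 (Num.min (h * a k - 1 / (b k * lam k)) (power_cap lam c Pc k)).
Proof.
rewrite /water_filling /= => m0.
set w := h * a k - _; set m := power_cap _ _ _ _ in m0 *.
by case: (ltP w m) => wm; case: (ltP 0 w) => w0 /=; rewrite // max_r // ltW.
Qed.

Lemma water_fillingP (R : realType) (I : finType) (a b lam c : I -> R)
    (Pc h : R) (k : I) (x : R) :
  let w := h * a k - 1 / (b k * lam k) in
  let m := power_cap lam c Pc k in
  0 < m ->
  water_filling a b lam c Pc h k = x <->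
  [/\ 0 <= x <= m, x < m -> w <= x & 0 < x -> x <= w].
Proof.
move=> w m m0; rewrite water_fillingE // -/w -/m; clearbody w m.
split=> [<-|[/andP[x0 xm] xw wx]].
  by case: (ltP w m) => wm; [case: (ltP 0 w) => w0|rewrite (max_r (ltW m0))];
    split; try apply/andP; try split; try move=> ?; lra.
case: (ltP x m) => [/xw {}xw|mx]; case: (ltP 0 x) => [/wx {}wx|x0'];
  by case: (ltP w m) => wm; [case: (ltP 0 w) => w0|rewrite (max_r (ltW m0))]; lra.
Qed.

(** Clearing the positive denominators turns both sides into [h * a * beta <= 1 + beta * x]. *)
Lemma le_marginal (R : realType) (a beta h x : R) :
  0 < h -> 0 < beta -> 0 <= x ->
  (h * a - 1 / beta <= x) = (a * beta / (1 + beta * x) <= 1 / h).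
Proof.
move=> h0 b0 x0; have d0 : 0 < 1 + beta * x by nra.
rewrite ler_pdivrMr // mulrAC ler_pdivlMr // mul1r.
rewrite -(ler_pM2r b0) mulrBl mulVf ?gt_eqF // lerBlDr.
by congr (_ <= _); ring.
Qed.

Lemma ge_marginal (R : realType) (a beta h x : R) :
  0 < h -> 0 < beta -> 0 <= x ->
  (x <= h * a - 1 / beta) = (1 / h <= a * beta / (1 + beta * x)).
Proof.
move=> h0 b0 x0; have d0 : 0 < 1 + beta * x by nra.
rewrite ler_pdivlMr // mulrAC ler_pdivrMr // mul1r.
rewrite -(ler_pM2r b0) mulrBl mulVf ?gt_eqF // lerBrDr.
by congr (_ <= _); ring.
Qed.

(** * Unique optimality of the water-filling point *)

Lemma water_filling_gain (R : realType) (I : finType) (a b lam c : I -> R)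
    (Pc h : R) (k : I) (q : R) :
  0 < a k -> 0 < b k -> 0 < lam k -> 0 < power_cap lam c Pc k -> 0 < h ->
  0 <= q <= power_cap lam c Pc k -> q != water_filling a b lam c Pc h k ->
  a k * ln (1 + b k * lam k * q) - 1 / h * q <
  a k * ln (1 + b k * lam k * water_filling a b lam c Pc h k)
    - 1 / h * water_filling a b lam c Pc h k.
Proof.
move=> a0 b0 l0 m0 h0 /andP[q0 qm] qW.
have [/andP[W0 Wm] Wlt Wgt] := (water_fillingP a b h _ m0).1 erefl.
move: qW W0 Wm Wlt Wgt; set W := water_filling _ _ _ _ _ _ _ => qW W0 Wm Wlt Wgt.
have B0 := mulr_gt0 b0 l0; set B := b k * lam k in B0 Wlt Wgt *.
have qp : 0 < 1 + B * q by nra.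
have Wp : 0 < 1 + B * W by nra.
have ne : 1 + B * q != 1 + B * W.
  apply: contra_neq qW => /addrI; exact: (mulfI (lt0r_neq0 B0)).
have := ln_sub_lt qp Wp ne; rewrite -(ltr_pM2l a0) => lnW.
set g := a k * B / (1 + B * W).
have gE : a k * ((1 + B * q - (1 + B * W)) / (1 + B * W)) = g * (q - W).
  by rewrite /g; field; rewrite gt_eqF.
(* By the tangent inequality the gain of [q] over [W] is strictly below this product. If [q < W]
   then [0 < W], so the slope is nonnegative; if [W < q] then [W] is below the cap, so it is
   nonpositive. *)
suff: (g - 1 / h) * (q - W) <= 0 by rewrite gE in lnW; lra.
case: (ltP q W) => qlt.
  have gh : 1 / h <= g by rewrite -ge_marginal // Wgt //; lra.
  by nra.
case: (ltP W q) => qgt; last by nra.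
have gh : g <= 1 / h by rewrite -le_marginal // Wlt //; lra.
by nra.
Qed.

(** Assuming maximal total power, rather than a spent budget, covers both the budget equation and
    the case where all caps are saturated. *)
Lemma water_filling_optimal (R : realType) (I : finType)
    (a b lam c : I -> R) (Pc Ec h : R) :
  (forall k, 0 < a k) -> (forall k, 0 < b k) -> (forall k, 0 < lam k) ->
  (forall k, 0 < power_cap lam c Pc k) -> 0 < h ->
  \sum_k water_filling a b lam c Pc h k <= Ec ->
  (forall q, trpm_feasible lam c Pc Ec q ->
    \sum_k q k <= \sum_k water_filling a b lam c Pc h k) ->
  forall p, trpm_optimal a b lam c Pc Ec p <->
    (forall k, p k = water_filling a b lam c Pc h k).
Proof.
move=> a0 b0 l0 m0 h0 WEc qW p.
set W := water_filling a b lam c Pc h in WEc qW *.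
pose phi k x := a k * ln (1 + b k * lam k * x) - 1 / h * x.
have phiE q : \sum_k phi k (q k) =
    total_received_power a b lam q - 1 / h * \sum_k q k.
  by rewrite sumrB -mulr_sumr.
have phiW k x : 0 <= x <= power_cap lam c Pc k -> phi k x <= phi k (W k).
  move=> xm; have [->//|xW] := eqVneq x (W k).
  exact/ltW/water_filling_gain.
have fW : trpm_feasible lam c Pc Ec W.
  by split=> // k; have [] := (water_fillingP a b h _ (m0 k)).1 erefl.
have le_h q : trpm_feasible lam c Pc Ec q ->
    1 / h * \sum_k q k <= 1 / h * \sum_k W k.
  by move=> fq; rewrite ler_pM2l ?divr_gt0 //; exact: qW.
split=> [[fp pmax]|pW].
  have phip k : 0 <= phi k (W k) - phi k (p k).
    by rewrite subr_ge0; apply: phiW; exact: fp.1.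
  (* The sum is nonpositive as well: [p] is at least as good as [W] and its total power, priced at
     [1 / h], is no larger. Hence every nonnegative term vanishes. *)
  have : \sum_k (phi k (W k) - phi k (p k)) = 0.
    apply/eqP; rewrite eq_le sumr_ge0 // andbT sumrB !phiE.
    have := pmax W fW; have := le_h p fp; lra.
  move/psumr_eq0P => e k; apply/eqP/negPn/negP => pWk.
  have := water_filling_gain (a0 k) (b0 k) (l0 k) (m0 k) h0 (fp.1 k) pWk.
  by have := e (fun k _ => phip k) k isT; rewrite /phi /W; lra.
have -> : p = W by exact: funext.
split=> // q fq.
have : \sum_k phi k (q k) <= \sum_k phi k (W k).
  by apply: ler_sum => k _; apply: phiW; exact: fq.1.
by rewrite !phiE; have := le_h q fq; lra.
Qed.

(** * Choice of the level [h] *)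

Lemma continuous_water_filling (R : realType) (I : finType)
    (a b lam c : I -> R) (Pc : R) :
  (forall k, 0 < power_cap lam c Pc k) ->
  continuous (fun h : R => \sum_k water_filling a b lam c Pc h k).
Proof.
move=> m0; apply: continuous_big => [|k _].
  exact: add_continuous.
have -> : (fun h : R => water_filling a b lam c Pc h k) =
    cst 0 \max ((fun h => h * a k - 1 / (b k * lam k))
                \min cst (power_cap lam c Pc k)).
  by apply/funext => h; rewrite water_fillingE.
move=> h; apply: continuous_max; first exact: cst_continuous.
apply: continuous_min; last exact: cst_continuous.
by apply: cvgB; [exact: mulrr_continuous|exact: cvg_cst].
Qed.

Lemma water_filling_le0 (R : realType) (I : finType) (a b lam c : I -> R)
    (Pc h : R) (k : I) :
  0 < a k -> 0 < b k -> 0 < lam k -> 0 < power_cap lam c Pc k -> h <= 0 ->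
  water_filling a b lam c Pc h k = 0.
Proof.
move=> a0 b0 l0 m0 h0; apply/water_fillingP => //.
have : 0 < 1 / (b k * lam k) by rewrite divr_gt0 ?mulr_gt0.
by split; [rewrite lexx ltW| |]; nra.
Qed.

Lemma water_filling_saturated (R : realType) (I : finType)
    (a b lam c : I -> R) (Pc : R) :
  (forall k, 0 < a k) -> (forall k, 0 < b k) -> (forall k, 0 < lam k) ->
  (forall k, 0 < power_cap lam c Pc k) ->
  exists2 h, 0 < h &
    forall k, water_filling a b lam c Pc h k = power_cap lam c Pc k.
Proof.
move=> a0 b0 l0 m0.
(* [t k] is the level at which sensor [k] just reaches its cap. The sum dominates every [t k], and
   the added 1 keeps the level positive even if [I] is empty. *)
pose t k := (power_cap lam c Pc k + 1 / (b k * lam k)) / a k.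
have t0 k : 0 <= t k.
  by rewrite ltW // divr_gt0 // addr_gt0 // divr_gt0 // mulr_gt0.
have st : 0 <= \sum_k t k by apply: sumr_ge0.
exists (1 + \sum_k t k); first by lra.
move=> k; apply/water_fillingP => //; split; [by rewrite lexx ltW|lra|move=> _].
have : t k <= \sum_k t k by rewrite (bigD1 k) //= lerDl sumr_ge0.
rewrite /t ler_pdivrMr // -/(t _); have := a0 k.
set S := \sum_k _; set u := 1 / _; set m := power_cap _ _ _ _; nra.
Qed.

(** * Stationarity and the KKT multipliers *)

(* The Lagrangian is a sum of functions of the single powers, so fixing all
   powers but one leaves one summand and a constant. *)
Lemma is_derive_trpm_lagrangian (R : realType) (I : finType)
    (a b lam c : I -> R) (Pc Ec nu : R) (mu omega p : I -> R) (k : I) :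
  0 < 1 + b k * lam k * p k ->
  is_derive (p k) (1 : R)
    (fun x : R => trpm_lagrangian a b lam c Pc Ec nu mu omega
                    [eta p with k |-> x])
    (a k * (b k * lam k) / (1 + b k * lam k * p k) - nu + mu k - omega k).
Proof.
move=> d0.
pose C := \sum_(j | j != k) (a j * ln (1 + b j * lam j * p j))
  - nu * (\sum_(j | j != k) p j - Ec) + \sum_(j | j != k) mu j * p j
  - \sum_(j | j != k) omega j * (p j - power_cap lam c Pc j)
  + omega k * power_cap lam c Pc k.
have sumE (F : I -> R -> R) x : \sum_j F j ([eta p with k |-> x] j) =
    F k x + \sum_(j | j != k) F j (p j).
  rewrite (bigD1 k) //= eqxx; congr (_ + _).
  by apply: eq_bigr => j /negPf /= ->.
have -> : (fun x : R => trpm_lagrangian a b lam c Pc Ec nu mu omega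
                    [eta p with k |-> x]) =
   (fun x : R => a k * ln (1 + b k * lam k * x)
    + (- nu + mu k - omega k) * x + C).
  apply/funext => x; rewrite /trpm_lagrangian /total_received_power.
  rewrite (sumE (fun j x => a j * ln (1 + b j * lam j * x))).
  rewrite (sumE (fun j x => x)) (sumE (fun j x => mu j * x)).
  rewrite (sumE (fun j x => omega j * (x - power_cap lam c Pc j))) /C.
  by ring.
have lnd := is_derive1_ln d0.
have affd : is_derive (p k) (1 : R) (fun x => 1 + b k * lam k * x) (b k * lam k).
  by apply: is_derive_eq; rewrite add0r mul1r /GRing.scale /= mulr1.
have compd := @is_derive1_comp R (@ln R) (fun x => 1 + b k * lam k * x)
  _ _ _ lnd affd.
(* As an explicit composition, the logarithmic term matches the chain rule fact [compd]. *)
have -> : (fun x => a k * ln (1 + b k * lam k * x) +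
    (- nu + mu k - omega k) * x + C) =
  (fun x => a k * (@ln R \o (fun x => 1 + b k * lam k * x)) x +
    (- nu + mu k - omega k) * x + C) by [].
apply: is_derive_eq.
by rewrite /GRing.scale /=; ring.
Qed.

Lemma water_filling_multiplier (R : realType) (I : finType)
    (a b lam c : I -> R) (Pc Ec h : R) :
  (forall k, 0 < b k) -> (forall k, 0 < lam k) ->
  (forall k, 0 < power_cap lam c Pc k) -> 0 < h ->
  \sum_k water_filling a b lam c Pc h k = Ec ->
  budget_multiplier a b lam c Pc Ec (water_filling a b lam c Pc h) (1 / h).
Proof.
move=> b0 l0 m0 h0 WEc.
set W := water_filling a b lam c Pc h in WEc *.
pose g k := a k * (b k * lam k) / (1 + b k * lam k * W k).
have Wm k : 0 <= W k <= power_cap lam c Pc k.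
  by have [] := (water_fillingP a b h _ (m0 k)).1 erefl.
have W0 k : 0 <= W k by have /andP[] := Wm k.
have B0 k : 0 < b k * lam k by rewrite mulr_gt0.
have W_lt k : W k < power_cap lam c Pc k -> g k <= 1 / h.
  rewrite /g -le_marginal //.
  by have [] := (water_fillingP a b h _ (m0 k)).1 erefl.
have W_gt k : 0 < W k -> 1 / h <= g k.
  rewrite /g -ge_marginal //.
  by have [] := (water_fillingP a b h _ (m0 k)).1 erefl.
(* Stationarity reads [omega k - mu k = g k - 1 / h], so the multipliers are taken as the negative
   and positive parts of the right-hand side. *)
exists (fun k => Num.max 0 (1 / h - g k)), (fun k => Num.max 0 (g k - 1 / h)).
split.
- by split=> //; rewrite WEc.
- by split=> [|k]; [rewrite ltW // divr_gt0|rewrite !le_max !lexx].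
- by rewrite WEc subrr mulr0.
- move=> k; split.
    have [/W_gt gk|Wk] := ltP 0 (W k); last first.
      by rewrite (@le_anti _ _ (W k) 0) ?mulr0 // Wk W0.
    by rewrite max_l ?mul0r // subr_le0.
  have [/W_lt gk|Wk] := ltP (W k) (power_cap lam c Pc k).
    by rewrite max_l ?mul0r // subr_le0.
  have /andP[_ Wle] := Wm k.
  by apply/eqP; rewrite mulf_eq0 subr_eq0 (eq_le (W k)) Wk Wle orbT.
move=> k; have d0 : 0 < 1 + b k * lam k * W k by have := B0 k; have := W0 k; nra.
have stat : g k - 1 / h + Num.max 0 (1 / h - g k)
    - Num.max 0 (g k - 1 / h) = 0.
  by case: (ltP (g k) (1 / h)) => gh;
    [rewrite max_r ?max_l|rewrite max_l ?max_r]; lra.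
by rewrite -[X in is_derive _ _ _ X]stat; exact: is_derive_trpm_lagrangian.
Qed.

(** Slackness kills [omega k] below the cap and [mu k] above zero; stationarity then leaves exactly
    the one-sided marginal inequalities at price [nu]. *)
Lemma budget_multiplier_water_filling (R : realType) (I : finType)
    (a b lam c : I -> R) (Pc Ec : R) (p : I -> R) (nu : R) :
  (forall k, 0 < b k) -> (forall k, 0 < lam k) ->
  (forall k, 0 < power_cap lam c Pc k) ->
  budget_multiplier a b lam c Pc Ec p nu -> 0 < nu ->
  forall k, p k = water_filling a b lam c Pc (1 / nu) k.
Proof.
move=> b0 l0 m0 [mu [omega [[pm _] [_ mo0] _ compl stat]]] nu0 k.
have B0 : 0 < b k * lam k by rewrite mulr_gt0.
have /andP[p0 pk] := pm k; have [mu0 om0] := mo0 k; have [mup omp] := compl k.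
have d0 : 0 < 1 + b k * lam k * p k by nra.
have nuV : 1 / (1 / nu) = nu by rewrite !div1r invrK.
(* The derivative is unique, so its explicit value equals 0. *)
have := @derive_val _ _ _ _ _ _ _ (stat k).
rewrite (@derive_val _ _ _ _ _ _ _
  (is_derive_trpm_lagrangian a c Pc Ec nu mu omega d0)).
move=> eq0; apply/esym/water_fillingP => //; split=> //.
- move=> plt; rewrite le_marginal ?divr_gt0 // nuV.
  suff om : omega k = 0 by lra.
  by apply/eqP; move/eqP: omp; rewrite mulf_eq0 subr_eq0 (lt_eqF plt) orbF.
- move=> pgt; rewrite ge_marginal ?divr_gt0 // nuV.
  suff mu' : mu k = 0 by lra.
  by apply/eqP; move/eqP: mup; rewrite mulf_eq0 (gt_eqF pgt) orbF.
Qed.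

Theorem theorem1 (R : realType) (I : finType) (a b lam c : I -> R)
    (Pc Ec : R)
    (ha : forall k, 0 < a k) (hb : forall k, 0 < b k)
    (hlam : forall k, 0 < lam k) (hc : forall k, 0 < c k)
    (hPc : 0 < Pc) (hEc : 0 < Ec) :
  [/\ (* the optimum is given by the formula, with the budget spent in full
         whenever the individual bounds allow it *)
      exists h : R,
        [/\ 0 < h,
            forall p : I -> R, trpm_optimal a b lam c Pc Ec p <->
              (forall k, p k = water_filling a b lam c Pc h k)
          & Ec <= \sum_k power_cap lam c Pc k ->
            \sum_k water_filling a b lam c Pc h k = Ec],
      (* every h solving the budget equation gives the optimum and is the
         reciprocal of a multiplier of the budget constraint *)
      forall h : R, \sum_k water_filling a b lam c Pc h k = Ec ->
        [/\ 0 < h,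
            forall p : I -> R, trpm_optimal a b lam c Pc Ec p <->
              (forall k, p k = water_filling a b lam c Pc h k)
          & budget_multiplier a b lam c Pc Ec
              (water_filling a b lam c Pc h) (1 / h)]
    & (* conversely, every positive multiplier arises in this way *)
      forall (p : I -> R) (nu : R),
        trpm_optimal a b lam c Pc Ec p ->
        budget_multiplier a b lam c Pc Ec p nu -> 0 < nu ->
        \sum_k p k = Ec /\
        (forall k, p k = water_filling a b lam c Pc (1 / nu) k)].
Proof.
have m0 k : 0 < power_cap lam c Pc k by exact: power_cap_gt0.
have box q : trpm_feasible lam c Pc Ec q ->
    \sum_k q k <= \sum_k power_cap lam c Pc k.
  by move=> [qm _]; apply: ler_sum => k _; have /andP[] := qm k.
have budget h : \sum_k water_filling a b lam c Pc h k = Ec ->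
    0 < h /\ forall p : I -> R, trpm_optimal a b lam c Pc Ec p <->
              (forall k, p k = water_filling a b lam c Pc h k).
  (* A nonpositive level would give total power 0, contradicting [0 < Ec]. *)
  move=> hE; have h0 : 0 < h.
    rewrite ltNge; apply/negP => h0; move: hEc; rewrite -hE big1 ?ltxx // => k _.
    exact: water_filling_le0.
  split=> //; apply: water_filling_optimal => // [|q [_ qE]]; rewrite hE //.
split.
- have [H H0 HE] := water_filling_saturated ha hb hlam m0.
  have sumH : \sum_k water_filling a b lam c Pc H k =
      \sum_k power_cap lam c Pc k by apply: eq_bigr => k _; exact: HE.
  (* If the caps total less than [Ec], saturation is optimal and the budget claim is vacuous.
     Otherwise the total power runs continuously from 0 at level 0 to the sum of the caps at [H],
     hence passes through [Ec]. *)
  have [cEc|Ecc] := ltP (\sum_k power_cap lam c Pc k) Ec.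
    exists H; split=> //.
    by apply: water_filling_optimal => //; rewrite sumH // ltW.
  have sum0 : \sum_k water_filling a b lam c Pc 0 k = 0.
    by apply: big1 => k _; exact: water_filling_le0.
  have cW := continuous_subspaceT (A := `[0, H]%classic)
    (continuous_water_filling (a := a) (b := b) m0).
  have sumEc : Num.min (\sum_k water_filling a b lam c Pc 0 k)
        (\sum_k water_filling a b lam c Pc H k) <= Ec <=
      Num.max (\sum_k water_filling a b lam c Pc 0 k)
        (\sum_k water_filling a b lam c Pc H k).
    by rewrite sum0 sumH ge_min le_max Ecc (ltW hEc) orbT.
  have [h _ hE] := IVT (ltW H0) cW sumEc.
  by have [h0 hopt] := budget h hE; exists h.
- move=> h hE; have [h0 hopt] := budget h hE.
  by split=> //; exact: water_filling_multiplier.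
- move=> p nu _ nuP nu0; split; last exact: budget_multiplier_water_filling nuP nu0.
  have [mu [omega [_ _ /eqP]]] := nuP.
  by rewrite mulf_eq0 (gt_eqF nu0) subr_eq0 => /eqP.
Qed.
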